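(* Let $m,n\ge1$, let $\Omega\subset\mathbb{R}^{m+n}$ be the open set of admissible states $\tilde{\mathbf{U}}$, and let $\mathbf{J_R}:\Omega\to\mathbb{R}^{(m+n)\times(m+n)}$ be a differentiable matrix-valued function, the Jacobian matrix of a hyperbolic system $\partial_t\tilde{\mathbf{U}}+\mathbf{J_R}(\tilde{\mathbf{U}})\partial_x\tilde{\mathbf{U}}=\tilde{\mathbf{L}}(\tilde{\mathbf{U}})$; that is, for every $\tilde{\mathbf{U}}\in\Omega$ the matrix $\mathbf{J_R}(\tilde{\mathbf{U}})$ has real eigenvalues $\lambda_1,\dots,\lambda_{m+n}$ (listed with multiplicity) and $m+n$ linearly independent eigenvectors. For $\mathbf{P}=(P_1,\dots,P_{m+n})^T\in\mathbb{R}^{m+n}$ let $\mathbf{D}=\mathbf{D}(\tilde{\mathbf{U}},\mathbf{P})$ be the matrix with entries $$\mathbf{D}_{k,j}=\sum_{i=1}^{m+n}\left(\frac{\partial(\mathbf{J_R})_{i,k}}{\partial\tilde{\mathbf{U}}_j}-\frac{\partial(\mathbf{J_R})_{i,j}}{\partial\tilde{\mathbf{U}}_k}\right)P_i ,\qquad k,j=1,\dots,m+n.$$ If there exists a differentiable function $\tilde{\mathbf{K}}:\Omega\to\mathbb{R}^{m+n}$ such that $$\mathbf{J_R}(\tilde{\mathbf{U}})=\frac{\partial\tilde{\mathbf{K}}(\tilde{\mathbf{U}})}{\partial\tilde{\mathbf{U}}}\quad\text{for all }\tilde{\mathbf{U}}\in\Omega,$$ then $\mathbf{D}=\mathbf{0}$,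 and the unified primal-dual system for $\mathbf{Q}=(\tilde{\mathbf{U}},\mathbf{P})^T\in\mathbb{R}^{2(m+n)}$, $$\partial_t\mathbf{Q}+\mathbf{A}(\mathbf{Q})\partial_x\mathbf{Q}=\mathbf{S}(\mathbf{Q}),\qquad \mathbf{A}(\mathbf{Q})=\begin{pmatrix}\mathbf{J_R}&\mathbf{0}\\ \mathbf{D}&\mathbf{J_R}^T\end{pmatrix},$$ is hyperbolic. The eigenvalues of $\mathbf{A}(\mathbf{Q})$ are $\lambda_1,\dots,\lambda_{m+n}$, each member of this list being counted with multiplicity $2$, and corresponding linearly independent eigenvectors are $$\{[\mathbf{v}_1,\mathbf{0}_{m+n}]^T,[\mathbf{0}_{m+n},\mathbf{v}^t_1]^T,\dots,[\mathbf{v}_{m+n},\mathbf{0}_{m+n}]^T,[\mathbf{0}_{m+n},\mathbf{v}^t_{m+n}]^T\},$$ where $\mathbf{v}_1,\dots,\mathbf{v}_{m+n}$ are linearly independent eigenvectors of $\mathbf{J_R}$ with $\mathbf{v}_i$ associated with $\lambda_i$, $\mathbf{v}^t_1,\dots,\mathbf{v}^t_{m+n}$ are linearly independent eigenvectors of $\mathbf{J_R}^T$ with $\mathbf{v}^t_i$ associated with $\lambda_i$, and $\mathbf{0}_{m+n}$ is the zero vector of $\mathbb{R}^{m+n}$.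
   Context: A first-order system $\partial_t\mathbf{W}+\mathbf{M}(\mathbf{W})\partial_x\mathbf{W}=\mathbf{s}(\mathbf{W})$ is called hyperbolic if at every state $\mathbf{M}(\mathbf{W})$ has only real eigenvalues and a complete set of linearly independent eigenvectors (the eigenvalues need not be distinct). In the paper, $\tilde{\mathbf{U}}=[\mathbf{U},\mathbf{b}]^T$ collects $m$ state variables $\mathbf{U}$ and $n$ time-independent parameters $\mathbf{b}$, $\mathbf{J_R}=\partial\tilde{\mathbf{R}}/\partial\tilde{\mathbf{U}}+\tilde{\mathbf{M}}$ is the Jacobian of the constraint PDE $\partial_t\tilde{\mathbf{U}}+\partial_x\tilde{\mathbf{R}}(\tilde{\mathbf{U}})+\tilde{\mathbf{M}}(\tilde{\mathbf{U}})\partial_x\tilde{\mathbf{U}}=\tilde{\mathbf{L}}(\tilde{\mathbf{U}})$, and $\mathbf{P}$ is the adjoint state. The lower block of the unified system is the adjoint equation. The source term $\mathbf{S}(\mathbf{Q})$ contains no $x$-derivatives of $\mathbf{Q}$ and so plays no role in hyperbolicity. *)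

(* Defs.v *)
From HB Require Import structures.
From mathcomp Require Import all_boot all_order all_algebra.
From mathcomp Require Import all_classical all_reals all_analysis.

Set Implicit Arguments.
Unset Strict Implicit.
Unset Printing Implicit Defensive.

Import Order.TTheory GRing.Theory Num.Theory.
Import numFieldNormedType.Exports.

Local Open Scope classical_set_scope.
Local Open Scope ring_scope.

(* Vectors are columns and eigenvectors are right eigenvectors; MathComp's
   [eigenvalue]/[eigenspace] act on rows, hence these definitions. *)
Definition is_eigenvector (R : realType) (N : nat) (M : 'M[R]_N) (a : R)
    (v : 'cV[R]_N) : Prop :=
  v != 0 /\ M *m v = a *: v.

(* lam lists all the (complex) eigenvalues of M with algebraic multiplicity;
   in particular they are all real. *)
Definition eigenvalues_are (R : realType) (N : nat) (M : 'M[R]_N)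
    (lam : 'I_N -> R) : Prop :=
  char_poly M = \prod_(i < N) ('X - (lam i)%:P).

Definition lin_indep (R : realType) (N k : nat) (v : 'I_k -> 'cV[R]_N) : Prop :=
  free [seq v i | i <- enum 'I_k].

Definition hyperbolic_mx (R : realType) (N : nat) (M : 'M[R]_N) : Prop :=
  (exists lam : 'I_N -> R, eigenvalues_are M lam) /\
  (exists v : 'I_N -> 'cV[R]_N,
     lin_indep v /\ forall i, exists a : R, is_eigenvector M a (v i)).

(* Hyperbolicity of d_t W + M(W) d_x W = s(W), W ranging over the set of states
   S; the source s has no bearing on it. *)
Definition hyperbolic (R : realType) (N : nat) (S : set 'cV[R]_N)
    (M : 'cV[R]_N -> 'M[R]_N) : Prop :=
  forall W, S W -> hyperbolic_mx (M W).

Definition eigenbasis (R : realType) (N : nat) (M : 'M[R]_N)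
    (lam : 'I_N -> R) (v : 'I_N -> 'cV[R]_N) : Prop :=
  lin_indep v /\ forall i, is_eigenvector M (lam i) (v i).

Definition partial (R : realType) (N : nat) (j : 'I_N) (f : 'cV[R]_N -> R)
    (U : 'cV[R]_N) : R :=
  'D_(delta_mx j ord0) f U.

(* (i, j) entry d K_i / d U_j. The library's [jacobian] is the transpose of
   this matrix, and is for row vectors. *)
Definition jacobian_mx (R : realType) (N : nat) (K : 'cV[R]_N -> 'cV[R]_N)
    (U : 'cV[R]_N) : 'M[R]_N :=
  \matrix_(i, j) partial j (fun W => K W i ord0) U.

Definition D_mx (R : realType) (N : nat) (J : 'cV[R]_N -> 'M[R]_N)
    (U P : 'cV[R]_N) : 'M[R]_N :=
  \matrix_(k, j) \sum_(i < N)
    (partial j (fun W => J W i k) U - partial k (fun W => J W i j) U)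
    * P i ord0.

(* The unified state Q stacks U above P. *)
Definition A_mx (R : realType) (N : nat) (J : 'cV[R]_N -> 'M[R]_N)
    (Q : 'cV[R]_(N + N)) : 'M[R]_(N + N) :=
  let U := usubmx Q in let P := dsubmx Q in
  block_mx (J U) 0 (D_mx J U P) (J U)^T.

Definition unified_states (R : realType) (N : nat) (Omega : set 'cV[R]_N) :
    set 'cV[R]_(N + N) :=
  [set Q | Omega (usubmx Q)].

(* Main.v *)
(* Along Omega the entries J_ik are the partial derivatives d_k K_i, so that
   D = 0 amounts to the symmetry of the second derivatives of each K_i at a point
   where the first partial derivatives are only known to be differentiable.  This
   is Young's form of Schwarz's theorem: the second difference
   f(a+hx+hy) - f(a+hx) - f(a+hy) + f(a), which is symmetric in x and y, equals
   h^2 D_y (D_x f) (a) + o(h^2) by the mean value theorem.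
   Then A = diag(J, J^T), and if V is an eigenbasis matrix of J, then V^-T is one
   of J^T with the same eigenvalues, so that diag(V, V^-T) diagonalizes A. *)
Require Import Defs.
From HB Require Import structures.
From mathcomp Require Import all_boot all_order all_algebra perm.
From mathcomp Require Import all_classical all_reals all_analysis.
From mathcomp Require Import ring lra.

Import Order.TTheory GRing.Theory Num.Theory.
Import numFieldNormedType.Exports.

Local Open Scope classical_set_scope.
Local Open Scope ring_scope.

(** * Symmetry of mixed second derivatives at a single point *)

Section Schwarz.
Context {R : realType} {V : normedModType R}.
Implicit Types (f g k : V -> R) (a v x y : V).

(** Reduces directional derivatives to one real variable, as the mean value theorem requires: the
    two difference quotients coincide term by term. *)
Lemma is_derive_line f a v (t : R) : differentiable f (a + t *: v) ->
  is_derive t 1 (fun s : R => f (a + s *: v)) ('D_v f (a + t *: v)).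
Proof.
move=> /(@diff_derivable _ _ _ _ _ v) df.
have E : (fun h : R => h^-1 *: (f (a + (h *: 1 + t) *: v) - f (a + t *: v)))
  = (fun h : R => h^-1 *: (f (h *: v + (a + t *: v)) - f (a + t *: v))).
  apply/funext => h; congr (_ *: (f _ - _)).
  by rewrite [h *: 1]mulr1 scalerDl addrCA.
by split; rewrite /derivable /derive/= E.
Qed.

Lemma differentiable_remainder g a (e : R) : differentiable g a -> 0 < e ->
  \forall v \near 0, `|g (a + v) - g a - 'd g a v| <= e * `|v|.
Proof.
move=> dg e0.
have /eqaddoP : (g \o shift a) = cst (g a) + 'd g a +o_ 0 id.
  exact: (diff_locally dg).
move=> /(_ e e0); apply: filterS => v /=.
by rewrite !fctE/= [v + a]addrC opprD addrA.
Qed.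

(* Mean value theorem for t |-> f(a+hy+tx) - f(a+tx), whose derivative
   g(a+hy+tx) - g(a+tx) is h D_y g(a) + o(h) uniformly in 0 <= t <= h. *)
Lemma second_difference f g a x y (e : R) : 0 < e ->
  (\forall u \near a, differentiable f u /\ 'D_x f u = g u) ->
  differentiable g a ->
  exists2 d : R, 0 < d & forall h : R, 0 < h -> h < d ->
    `|f (a + h *: y + h *: x) - f (a + h *: x) - f (a + h *: y) + f a
      - h ^+ 2 * 'D_y g a| <= e * h ^+ 2.
Proof.
move=> e0 df dg.
(* The summand 1 keeps [M] positive even when [x] and [y] vanish. For [0 <= c <= h], both
   [h *: y + c *: x] and [c *: x] have norm at most [h * M]. *)
pose M := `|x| + `|y| + 1.
have M0 : 0 < M by rewrite /M ltr_wpDl// addr_ge0.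
(* Two remainders of [g] will be added. On increments of norm at most [h * M] each is at most
   [e / 2 * h], and the mean value theorem supplies the second factor [h]. *)
have e'0 : 0 < e / (2 * M) by rewrite divr_gt0// mulr_gt0.
(* Recentring at 0 lets the hypothesis on [f] and the remainder bound on [g] share one radius
   [r]. *)
have df0 : \forall w \near (0 : V),
    differentiable f (a + w) /\ 'D_x f (a + w) = g (a + w).
  move: df => /nbhs_ballP[r /= r0 rf]; apply/nbhs_ballP; exists r => //= w.
  rewrite -ball_normE/= sub0r normrN => wr; apply: rf.
  by rewrite -ball_normE/= opprD addrA subrr sub0r normrN.
have : \forall w \near (0 : V), (differentiable f (a + w) /\ 'D_x f (a + w) = g (a + w)) /\
    `|g (a + w) - g a - 'd g a w| <= e / (2 * M) * `|w|.
  by apply: filterI => //; exact: differentiable_remainder.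
move=> /nbhs_ballP[r /= r0 Hr].
have small w : `|w| < r -> (differentiable f (a + w) /\ 'D_x f (a + w) = g (a + w)) /\
    `|g (a + w) - g a - 'd g a w| <= e / (2 * M) * `|w|.
  by move=> wr; apply: Hr; rewrite -ball_normE/= sub0r normrN.
exists (r / M); first by rewrite divr_gt0.
move=> h h0 hr.
have hM : h * M < r by rewrite -ltr_pdivlMr.
have le1 (c : R) : 0 <= c -> c <= h -> `|h *: y + c *: x| <= h * M.
  move=> c0 ch; apply: (le_trans (ler_normD _ _)).
  rewrite !normrZ !ger0_norm ?(ltW h0)// /M.
  have := normr_ge0 x; have := normr_ge0 y; nra.
have le2 (c : R) : 0 <= c -> c <= h -> `|c *: x| <= h * M.
  move=> c0 ch; rewrite !normrZ !ger0_norm// /M.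
  have := normr_ge0 x; have := normr_ge0 y; nra.
pose phi (t : R) := f (a + h *: y + t *: x) - f (a + t *: x).
pose dphi (t : R) := g (a + h *: y + t *: x) - g (a + t *: x).
have dphiP (t : R) : 0 <= t -> t <= h -> is_derive t 1 phi (dphi t).
  move=> t0 th; apply: is_deriveB; rewrite -?addrA.
    have [[fw <-] _] := small _ (le_lt_trans (le1 _ t0 th) hM).
    by rewrite addrA in fw *; exact: is_derive_line.
  have [[fw <-] _] := small _ (le_lt_trans (le2 _ t0 th) hM).
  exact: is_derive_line.
have [||c /[!in_itv]/= /andP[c0 ch] Ec] := @MVT R phi dphi 0 h h0.
- by move=> t /[!in_itv]/= /andP[t0 th]; exact: dphiP (ltW t0) (ltW th).
- apply: derivable_within_continuous => t /[!in_itv]/= /andP[t0 th].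
  by have [] := dphiP t t0 th.
rewrite subr0 in Ec.
have [_ r1] := small _ (le_lt_trans (le1 c (ltW c0) (ltW ch)) hM).
have [_ r2] := small _ (le_lt_trans (le2 c (ltW c0) (ltW ch)) hM).
have {}r1 := le_trans r1 (ler_wpM2l (ltW e'0) (le1 c (ltW c0) (ltW ch))).
have {}r2 := le_trans r2 (ler_wpM2l (ltW e'0) (le2 c (ltW c0) (ltW ch))).
have EM : e / (2 * M) * (h * M) = e / 2 * h by field; rewrite gt_eqF.
rewrite EM in r1 r2.
rewrite deriveE// expr2.
have -> : f (a + h *: y + h *: x) - f (a + h *: x) - f (a + h *: y) + f a
   = phi h - phi 0.
  by rewrite /phi scale0r !addr0; ring.
rewrite {}Ec /dphi -[a + _ + _]addrA.
move: r1 r2; rewrite linearD linearZ/=.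
set g1 := g (a + (_ + _)); set g2 := g (a + _); set g0 := g a.
set dy := 'd _ a y; set dx := 'd _ a _.
rewrite [h *: dy]/(h * dy) => r1 r2.
(* The linear approximations of [g] at the two points share the terms [g0] and [dx]; their
   difference is exactly [h * dy], so only the two remainders survive. *)
have -> : (g1 - g2) * h - h * h * dy =
    ((g1 - g0 - (h * dy + dx)) - (g2 - g0 - dx)) * h by ring.
rewrite normrM (gtr0_norm h0) mulrA ler_pM2r//.
apply: le_trans (ler_normB _ _) _.
by apply: le_trans (lerD r1 r2) _; lra.
Qed.

(** The second difference is symmetric in [x] and [y], so for small [h] both [h ^+ 2 * 'D_y g a] and
    [h ^+ 2 * 'D_x k a] lie within [e / 2 * h ^+ 2] of the same number. Dividing by [h ^+ 2] bounds
    their gap by an arbitrary [e]. *)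
Lemma derive_comm f g k a x y :
  (\forall u \near a, [/\ differentiable f u, 'D_x f u = g u & 'D_y f u = k u]) ->
  differentiable g a -> differentiable k a -> 'D_y g a = 'D_x k a.
Proof.
move=> df dx dy; apply/eqP; rewrite -subr_eq0 -normr_le0.
have dfx : \forall u \near a, differentiable f u /\ 'D_x f u = g u.
  by apply: filterS df => u [].
have dfy : \forall u \near a, differentiable f u /\ 'D_y f u = k u.
  by apply: filterS df => u [].
apply/ler_addgt0Pl => e e0; rewrite addr0.
have e20 : 0 < e / 2 by rewrite divr_gt0.
have [d1 d10 H1] := second_difference _ _ _ _ y _ e20 dfx dx.
have [d2 d20 H2] := second_difference _ _ _ _ x _ e20 dfy dy.
pose h := Num.min d1 d2 / 2.
have h0 : 0 < h by rewrite divr_gt0// lt_min d10.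
have hm : h < Num.min d1 d2.
  by rewrite /h ltr_pdivrMr// ltr_pMr ?ltr1n// lt_min d10.
move: hm; rewrite lt_min => /andP[/(H1 h h0){}H1 /(H2 h h0){}H2].
rewrite -(ler_pM2r (exprn_gt0 2 h0)) -[X in _ * X <= _]gtr0_norm ?exprn_gt0//.
rewrite -normrM.
(* Rewrites the far corner in [H2] as the one in [H1], so that both estimates concern the same four
   values of [f]. *)
move: H1 H2; rewrite -[a + h *: x + h *: y]addrA [h *: x + h *: y]addrC addrA.
set A := 'D_y _ _; set B := 'D_x _ _.
set p := f (_ + _ + _); set q := f (_ + _); set s := f (_ + _) => H1 H2.
have -> : (A - B) * h ^+ 2 = (p - s - q + f a - h ^+ 2 * B)
   - (p - q - s + f a - h ^+ 2 * A) by ring.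
apply: le_trans (ler_normB _ _) _; apply: le_trans (lerD H2 H1) _.
by rewrite -mulrDl -splitr.
Qed.
End Schwarz.

(** * Eigenbases as invertible diagonalizing matrices *)

Section Eigenbases.
Context {R : realType}.

Definition cols_mx {N : nat} (v : 'I_N -> 'cV[R]_N) : 'M[R]_N :=
  \matrix_(i, j) v j i ord0.

Lemma col_cols_mx N (v : 'I_N -> 'cV[R]_N) j : col j (cols_mx v) = v j.
Proof. by apply/colP => i; rewrite !mxE. Qed.

Lemma mul_cols_mx N (v : 'I_N -> 'cV[R]_N) (k : 'cV[R]_N) :
  cols_mx v *m k = \sum_i k i ord0 *: v i.
Proof.
apply/colP => i; rewrite mxE summxE; apply: eq_bigr => j _.
by rewrite !mxE mulrC.
Qed.

Lemma lin_indep_unitmx N (v : 'I_N -> 'cV[R]_N) :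
  lin_indep v <-> cols_mx v \in unitmx.
Proof.
have nthv (i : 'I_N) : [tuple v i | i < N]`_i = v i.
  by rewrite -tnth_nth tnth_mktuple.
rewrite /lin_indep -[map _ _]/(tval [tuple v i | i < N]); split.
  move=> /freeP freev; rewrite -unitmx_tr -row_free_unit.
  apply: inj_row_free => k /(congr1 trmx); rewrite trmx_mul trmxK trmx0.
  rewrite mul_cols_mx => k0; apply/rowP => i; rewrite mxE.
  rewrite -(freev (k 0) _ i)//; rewrite -[RHS]k0.
  by apply: eq_bigr => j _; rewrite nthv mxE.
move=> uV; apply/freeP => k k0 i.
pose kv : 'cV[R]_N := \col_i k i.
have : cols_mx v *m kv = 0.
  by rewrite mul_cols_mx -[RHS]k0; apply: eq_bigr => j _; rewrite nthv mxE.
move=> /(congr1 (mulmx (invmx (cols_mx v)))); rewrite mulKmx// mulmx0.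
by move=> /colP/(_ i); rewrite !mxE.
Qed.

(** Column by column, the matrix identity is the family of eigenvector equations; transposes and
    blocks can then be treated by matrix algebra alone. *)
Lemma eigenbasisP N (M : 'M[R]_N) (lam : 'I_N -> R) (v : 'I_N -> 'cV[R]_N) :
  eigenbasis M lam v <->
  cols_mx v \in unitmx /\
  M *m cols_mx v = cols_mx v *m diag_mx (\row_i lam i).
Proof.
have colsE : M *m cols_mx v = cols_mx v *m diag_mx (\row_i lam i) <->
    forall i, M *m v i = lam i *: v i.
  have cE j : col j (M *m cols_mx v) = M *m v j.
    by rewrite -[v j]col_cols_mx !colE mulmxA.
  have dE j : col j (cols_mx v *m diag_mx (\row_i lam i)) = lam j *: v j.
    by apply/colP => i; rewrite mul_mx_diag !mxE mulrC.
  split=> [E j|E]; first by rewrite -cE E dE.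
  by apply/matrixP => i j; have := cE j; rewrite E -dE => /colP/(_ i); rewrite !mxE.
split=> [[/[dup] fv /lin_indep_unitmx uv Mv]|[uv Mv]].
  by split=> //; apply/colsE => i; have [] := Mv i.
have fv : lin_indep v by apply/lin_indep_unitmx.
split=> // i; split; last by move/colsE: Mv.
by apply: (free_not0 fv); apply: map_f; rewrite mem_enum.
Qed.

(** With [V] the matrix of eigenvectors, (X - M) V = V (X - D) over the polynomial ring. Taking
    determinants and cancelling the nonzero constant det V leaves the characteristic polynomial of
    the diagonal matrix. *)
Lemma eigenbasis_eigenvalues_are N (M : 'M[R]_N) lam v :
  eigenbasis M lam v -> eigenvalues_are M lam.
Proof.
move=> /eigenbasisP[uV MV]; set D := diag_mx _ in MV.
have cpD : char_poly D = \prod_(i < N) ('X - (lam i)%:P).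
  rewrite char_poly_trig ?diag_mx_is_trig//.
  by apply: eq_bigr => i _; rewrite !mxE eqxx.
rewrite /eigenvalues_are -cpD.
have : char_poly_mx M *m map_mx polyC (cols_mx v) =
    map_mx polyC (cols_mx v) *m char_poly_mx D.
  by rewrite /char_poly_mx mulmxBl mulmxBr -!map_mxM MV scalar_mxC.
move=> /(congr1 determinant); rewrite !det_mulmx mulrC => /mulfI; apply.
rewrite det_map_mx polyC_eq0.
by move: uV; rewrite unitmxE unitfE.
Qed.

(* The two lists of eigenvalues are permutations of each other, since they are
   the roots of the same polynomial. *)
Lemma eigenbasis_permute N (M : 'M[R]_N) (lam mu : 'I_N -> R) v :
  eigenbasis M mu v -> eigenvalues_are M lam -> exists w, eigenbasis M lam w.
Proof.
move=> /[dup] /eigenbasis_eigenvalues_are Mmu [fv Mv] Mlam.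
have : perm_eq [tuple lam i | i < N] [tuple mu i | i < N].
  apply: prod_XsubC_eq; rewrite !big_tuple.
  have E (f : 'I_N -> R) : \prod_(i < N) ('X - (tnth [tuple f i | i < N] i)%:P)
      = \prod_(i < N) ('X - (f i)%:P).
    by apply: eq_bigr => i _; rewrite tnth_mktuple.
  by rewrite !E -Mlam -Mmu.
move=> /tuple_permP[s lamE].
have {}lamE i : lam i = mu (s i).
  have /(congr1 (fun t => tnth t i)) := val_inj lamE.
  by rewrite !tnth_mktuple.
exists (v \o s); split; last by move=> i /=; rewrite lamE; exact: Mv.
rewrite /lin_indep (perm_free (Y := [seq v i | i <- enum 'I_N]))//.
rewrite [X in perm_eq X](map_comp v s); apply: seq.perm_map; apply: uniq_perm.
- by rewrite map_inj_uniq ?enum_uniq//; exact: perm_inj.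
- exact: enum_uniq.
- move=> i; rewrite mem_enum; apply/mapP; exists (s^-1 i)%g.
    by rewrite mem_enum.
  by rewrite permKV.
Qed.

(** Hyperbolicity provides eigenvectors whose eigenvalues come in some unknown order; reindexing
    them matches the prescribed list [lam]. *)
Lemma hyperbolic_mx_eigenbasis N (M : 'M[R]_N) (lam : 'I_N -> R) :
  hyperbolic_mx M -> eigenvalues_are M lam -> exists v, eigenbasis M lam v.
Proof.
move=> [_ [v [fv /choice[mu Mv]]]]; apply: eigenbasis_permute.
by split; [exact: fv | exact: Mv].
Qed.

Lemma eigenbasis_hyperbolic_mx N (M : 'M[R]_N) lam v :
  eigenbasis M lam v -> hyperbolic_mx M.
Proof.
move=> /[dup] /eigenbasis_eigenvalues_are Mlam [fv Mv].
by split; [exists lam | exists v; split=> // i; exists (lam i)].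
Qed.

(** Transposing V^-1 M = D V^-1 shows that the columns of V^-T are eigenvectors of [M^T], in the
    same order of eigenvalues. *)
Lemma eigenbasis_tr N (M : 'M[R]_N) lam v :
  eigenbasis M lam v -> exists w, eigenbasis M^T lam w.
Proof.
move=> /eigenbasisP[uV MV]; set V := cols_mx v in uV MV.
exists (fun i => col i (invmx V)^T).
have W : cols_mx (fun i => col i (invmx V)^T) = (invmx V)^T.
  by apply/matrixP => i j; rewrite !mxE.
apply/eigenbasisP; rewrite W unitmx_tr unitmx_inv; split=> //.
rewrite -trmx_mul -[in RHS]tr_diag_mx -trmx_mul; congr trmx.
by rewrite -[M in LHS](mulmxK uV) MV -!mulmxA mulKmx// mulmxA.
Qed.

(** * Block-diagonal matrices and their eigenbases *)

Definition ord_sum {T : Type} {N} (f g : 'I_N -> T) (i : 'I_(N + N)) : T :=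
  match fintype.split i with inl j => f j | inr j => g j end.

Lemma ord_suml T N (f g : 'I_N -> T) i : ord_sum f g (lshift N i) = f i.
Proof. by rewrite /ord_sum (unsplitK (inl i)). Qed.

Lemma ord_sumr T N (f g : 'I_N -> T) i : ord_sum f g (rshift N i) = g i.
Proof. by rewrite /ord_sum (unsplitK (inr i)). Qed.

Definition block_vecs {N} (v w : 'I_N -> 'cV[R]_N) : 'I_(N + N) -> 'cV[R]_(N + N) :=
  ord_sum (fun i => col_mx (v i) 0) (fun i => col_mx 0 (w i)).

Lemma cols_block_vecs N (v w : 'I_N -> 'cV[R]_N) :
  cols_mx (block_vecs v w) = block_mx (cols_mx v) 0 0 (cols_mx w).
Proof.
apply/matrixP => i j; rewrite mxE /block_vecs -[j]splitK -[i]splitK.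
case: (fintype.split j) => {}j; case: (fintype.split i) => {}i /=;
  rewrite ?ord_suml ?ord_sumr ?block_mxEul ?block_mxEur ?block_mxEdl ?block_mxEdr
    ?col_mxEu ?col_mxEd !mxE//.
Qed.

Lemma eigenbasis_block N (A B : 'M[R]_N) lam mu v w :
  eigenbasis A lam v -> eigenbasis B mu w ->
  eigenbasis (block_mx A 0 0 B) (ord_sum lam mu) (block_vecs v w).
Proof.
move=> /eigenbasisP[uv Av] /eigenbasisP[uw Bw]; apply/eigenbasisP.
rewrite cols_block_vecs; split.
  by rewrite unitmxE det_lblock unitrM -!unitmxE uv.
have -> : \row_i ord_sum lam mu i = row_mx (\row_i lam i) (\row_i mu i).
  apply/rowP => i; rewrite mxE -[i]splitK.
  by case: (fintype.split i) => {}i /=;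
    rewrite ?ord_suml ?ord_sumr ?row_mxEl ?row_mxEr mxE.
by rewrite diag_mx_row !mulmx_block !mulmx0 !mul0mx !addr0 !add0r Av Bw.
Qed.

Lemma enum_ord_add p q :
  perm_eq (enum 'I_(p + q)) (map (lshift q) (enum 'I_p) ++ map (@rshift p q) (enum 'I_q)).
Proof.
apply: uniq_perm; first exact: enum_uniq.
  rewrite cat_uniq (map_inj_uniq (@lshift_inj p q)) (map_inj_uniq (@rshift_inj p q)) !enum_uniq.
  rewrite andbT/=; apply/hasPn => _ /mapP[i _ ->].
  by apply/mapP => -[j _] /eqP; rewrite eq_rlshift.
move=> i; rewrite mem_enum mem_cat; symmetry; apply/orP.
rewrite -[i]splitK; case: (fintype.split i) => j; [left|right];
  by apply: map_f; rewrite mem_enum.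
Qed.

Lemma perm_flatten_pairs (S : Type) (T : eqType) (f g : S -> T) (s : seq S) :
  perm_eq (flatten [seq [:: f i; g i] | i <- s]) (map f s ++ map g s).
Proof.
elim: s => //= i s IH; rewrite perm_cons.
by rewrite -[g i :: map g s]cat1s perm_sym perm_catCA perm_cons perm_sym.
Qed.

(** Freeness does not depend on the order of a list: the interleaved pairs are a permutation of all
    upper vectors followed by all lower ones. *)
Lemma free_block_vecs N (v w : 'I_N -> 'cV[R]_N) :
  lin_indep (block_vecs v w) ->
  free (flatten [seq [:: col_mx (v i) 0; col_mx 0 (w i)] | i <- enum 'I_N]).
Proof.
rewrite /lin_indep (perm_free (perm_flatten_pairs _ _ _ _ _)).
rewrite (perm_free (seq.perm_map _ (enum_ord_add N N))) map_cat -!map_comp.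
by rewrite (eq_map (ord_suml _ _ _ _)) (eq_map (ord_sumr _ _ _ _)).
Qed.
End Eigenbases.

(** * Vanishing of the coupling block and the unified system *)

Lemma D_mx_jacobian (R : realType) N (Omega : set 'cV[R]_N)
    (J : 'cV[R]_N -> 'M[R]_N) (K : 'cV[R]_N -> 'cV[R]_N) U P :
  open Omega -> (forall U, Omega U -> differentiable J U) ->
  (forall U, Omega U -> differentiable K U) ->
  (forall U, Omega U -> J U = jacobian_mx K U) -> Omega U -> D_mx J U P = 0.
Proof.
move=> oOm dJ dK JK OU; apply/matrixP => k j; rewrite !mxE.
apply: big1 => i _; apply/eqP; rewrite mulf_eq0 subr_eq0; apply/orP; left.
have dJi l : differentiable (fun W => J W i l) U.
  apply: (differentiable_comp (g := fun M : 'M[R]_N => M i l)); first exact: dJ.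
  exact: differentiable_coord.
(* The entries [J W i k] and [J W i j] are first partial derivatives of the component [K_i].
   Openness of [Omega] makes this hold on a whole neighbourhood of [U]. *)
apply/eqP/(derive_comm (fun W => K W i ord0)) => //.
have : \forall W \near U, Omega W by apply: open_nbhs_nbhs.
apply: filterS => W OW; split.
- apply: (differentiable_comp (g := fun M : 'cV[R]_N => M i ord0)); first exact: dK.
  exact: differentiable_coord.
- by rewrite JK// mxE.
- by rewrite JK// mxE.
Qed.

Theorem proposition2p2 (R : realType) (m n : nat)
    (m_ge1 : (1 <= m)%N) (n_ge1 : (1 <= n)%N)
    (Omega : set 'cV[R]_(m + n)) (Omega_open : open Omega)
    (J : 'cV[R]_(m + n) -> 'M[R]_(m + n))
    (J_diff : forall U, Omega U -> differentiable J U)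
    (J_hyp : hyperbolic Omega J)
    (K_ex : exists K : 'cV[R]_(m + n) -> 'cV[R]_(m + n),
        (forall U, Omega U -> differentiable K U) /\
        (forall U, Omega U -> J U = jacobian_mx K U)) :
  (forall U P : 'cV[R]_(m + n), Omega U -> D_mx J U P = 0) /\
  hyperbolic (unified_states Omega) (A_mx J) /\
  (forall (U P : 'cV[R]_(m + n)) (lam : 'I_(m + n) -> R),
     Omega U -> eigenvalues_are (J U) lam ->
     char_poly (A_mx J (col_mx U P)) =
       \prod_(i < m + n) ('X - (lam i)%:P) ^+ 2 /\
     (exists v, eigenbasis (J U) lam v) /\
     (exists vt, eigenbasis (J U)^T lam vt) /\
     (forall v vt : 'I_(m + n) -> 'cV[R]_(m + n),
        eigenbasis (J U) lam v -> eigenbasis (J U)^T lam vt ->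
        (forall i,
           is_eigenvector (A_mx J (col_mx U P)) (lam i) (col_mx (v i) 0) /\
           is_eigenvector (A_mx J (col_mx U P)) (lam i) (col_mx 0 (vt i))) /\
        free (flatten [seq [:: col_mx (v i) 0; col_mx 0 (vt i)]
                      | i <- enum 'I_(m + n)]))).
Proof.
have [K [dK JK]] := K_ex.
have D0 U P : Omega U -> D_mx J U P = 0 by exact: D_mx_jacobian JK.
have AE U P : Omega U -> A_mx J (col_mx U P) = block_mx (J U) 0 0 (J U)^T.
  by move=> OU; rewrite /A_mx col_mxKu col_mxKd D0.
split; first exact: D0.
split.
  move=> Q OQ; rewrite -[Q]vsubmxK AE//.
  have [[lam Jlam] _] := J_hyp _ OQ.
  have [v Jv] := hyperbolic_mx_eigenbasis _ _ _ (J_hyp _ OQ) Jlam.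
  have [w Jw] := eigenbasis_tr _ _ _ _ Jv.
  exact: eigenbasis_hyperbolic_mx (eigenbasis_block _ _ _ _ _ _ _ Jv Jw).
move=> U P lam OU Jlam; rewrite AE//.
have [v0 Jv0] := hyperbolic_mx_eigenbasis _ _ _ (J_hyp _ OU) Jlam.
have [w0 Jw0] := eigenbasis_tr _ _ _ _ Jv0.
split.
  rewrite (eigenbasis_eigenvalues_are _ _ _ _ (eigenbasis_block _ _ _ _ _ _ _ Jv0 Jw0)).
  (* The two halves of the index set carry the same list [lam], which produces the square. *)
  rewrite big_split_ord/= prodrXl expr2; congr (_ * _); apply: eq_bigr => i _.
    by rewrite ord_suml.
  by rewrite ord_sumr.
split; first by exists v0.
split; first by exists w0.
move=> v w Jv Jw; have [fvw Avw] := eigenbasis_block _ _ _ _ _ _ _ Jv Jw.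
split; last exact: free_block_vecs.
move=> i; have := Avw (lshift _ i); have := Avw (rshift _ i).
by rewrite /block_vecs !ord_suml !ord_sumr.
Qed.
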